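(* Let $m\ge 2$, $n\ge m$, $\epsilon\in[0,1]$ and $\gamma>0$. The cut-generation algorithm (described in the context) for the problem $\max\{f(z):z\in\Psi^m_n(0)\}$ terminates in finitely many iterations. Moreover, let $\widetilde\xi^m_n$ be the optimal value of the master problem at the last iteration, where the algorithm terminates, and let $\xi^m_n(-\gamma):=\max_{z\in\Psi^m_n(-\gamma)}f(z)$ and $\xi^m_n(0):=\max_{z\in\Psi^m_n(0)}f(z)$. Then $$\xi^m_n(0)\le\widetilde\xi^m_n\le\xi^m_n(-\gamma).$$
   Context: Let $\Theta=[\underline\theta,\overline\theta]$ be a compact interval, $\underline\theta<\overline\theta$. All random variables are defined on a probability space $(\Omega,\mathcal F,P)$ and take values in $\Theta$. $u_{ref}:\Theta\to\mathbb R$ is a fixed reference utility function, increasing and concave, with $u_{ref}(\underline\theta)=0$, $u_{ref}(\overline\theta)=1$. $\mu$ is a given nonnegative measure on $\Theta$ with $\mu(\Theta)=1$, and $M>1$ is a fixed constant. Bernstein polynomials: for $j=0,\dots,n$, let $\phi_j(x)=\binom nj\left(\frac{x-\underline\theta}{\overline\theta-\underline\theta}\right)^j\left(1-\frac{x-\underline\theta}{\overline\theta-\underline\theta}\right)^{n-j}$, $\phi=(\phi_0,\dots,\phi_n)^T$, and $B_n(x;c)=c^T\phi(x)$ for $c=(c_0,\dots,c_n)^T\in\mathbb R^{n+1}$. $\mathcal C^m_n(\epsilon)$ is the set of $c\in\mathbb R^{n+1}$ satisfying: (B1) $(-1)^{i-1}\Delta^i c_j\ge 0$ for $i=1,\dots,m$,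 $j=0,\dots,n-i$, where $\Delta^i c_j=\sum_{k=0}^i(-1)^k\binom ik c_{j+i-k}$; (B2) $c_0=0$, $c_n=1$; (B3) $c^TAc+g^Tc+r\le\epsilon^2$, where $A=\int_\Theta\phi\phi^T d\mu$, $g=-2\int_\Theta u_{ref}\phi\, d\mu$, $r=\int_\Theta u_{ref}^2\,d\mu$; (B4) $c_j\le\min\left\{1,\frac{M}{1-\epsilon}u_{ref}\left(\underline\theta+j\frac{\overline\theta-\underline\theta}{n}\right)\right\}$ for $j=0,\dots,n$ (for $\epsilon=1$ read as $c_j\le 1$). Decision setting: $\mathcal Z\subseteq\mathbb R^d$ is a decision region; $f:\mathbb R^d\to\mathbb R$ is an objective function; to each $z\in\mathcal Z$ is associated a $\Theta$-valued random variable $X(z)$; $Y$ is a $\Theta$-valued benchmark random variable. Define $\Pi_n(z,c)=\mathbb E[B_n(X(z);c)-B_n(Y;c)]$, $\pi^m_n(z)=\min_{c\in\mathcal C^m_n(\epsilon)}\Pi_n(z,c)$ and $\Psi^m_n(\delta)=\{z\in\mathcal Z:\pi^m_n(z)\ge\delta\}$ for $\delta\in\mathbb R$. Cut-generation algorithm (the optimization problems in Steps 2 and 3 are assumed to be solved exactly, with optimal solutions existing): Step 1. Choose $\gamma>0$ and set $k=0$. Step 2. Find an optimal solution $z^*_k$ of the master problem: maximize $f(z)$ subject to $\Pi_n(z,c^i)\ge 0$ for $i=1,\dots,k$, and $z\in\mathcal Z$. Step 3. Compute $\pi^m_n(z^*_k)$ and let $c^*_k\in\mathcal C^m_n(\epsilon)$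 be an optimal solution of $\min_{c\in\mathcal C^m_n(\epsilon)}\Pi_n(z^*_k,c)$. Step 4. If $\pi^m_n(z^*_k)\ge-\gamma$, exit. Otherwise set $c^{k+1}=c^*_k$, $k=k+1$, and return to Step 2. The maxima defining $\xi^m_n(0)$ and $\xi^m_n(-\gamma)$ are read as suprema if not attained. *)

(* Defs.v *)
From HB Require Import structures.
From mathcomp Require Export all_boot all_order all_algebra.
From mathcomp Require Export all_classical all_reals all_analysis.

Set Implicit Arguments.
Unset Strict Implicit.
Unset Printing Implicit Defensive.

Import Order.TTheory GRing.Theory Num.Theory.
Import numFieldNormedType.Exports.

Local Open Scope classical_set_scope.
Local Open Scope ring_scope.

(* Mirrors the library's [convex_function], with the inequality reversed. *)
Definition concave_function (R : numFieldType) (E : lmodType R)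
    (E' := convex_lmodType E) (D : set E') (f : E' -> R^o) : Prop :=
  forall t : {i01 R}, {in D &, forall x y : E',
    (conv t (f x) (f y) : R^o) <= f (conv t x y)}.

(* Coefficient vectors (c_0, ..., c_n) are columns [c : 'cV_n.+1], c_j being
   [c (inord j) 0]; throughout, Theta is the interval [a, b]. *)

Definition bernstein_basis (R : realType) (a b : R) (n : nat) (x : R) :
    'cV[R]_n.+1 :=
  \col_(j < n.+1) ('C(n, j)%:R * ((x - a) / (b - a)) ^+ j
                   * (1 - (x - a) / (b - a)) ^+ (n - j)).

Definition bernstein (R : realType) (a b : R) (n : nat) (c : 'cV[R]_n.+1)
    (x : R) : R :=
  (c^T *m bernstein_basis a b n x) 0 0.

Definition fin_diff (R : realType) (n : nat) (c : 'cV[R]_n.+1) (i j : nat) : R :=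
  \sum_(k < i.+1) (-1) ^+ k * 'C(i, k)%:R * c (inord (j + i - k)) 0.

Definition gram_mx (R : realType)
    (mu : {measure set (measurableTypeR R) -> \bar R}) (a b : R) (n : nat) :
    'M[R]_n.+1 :=
  \matrix_(i, j) \int[mu]_(x in `[a, b])
    (bernstein_basis a b n x *m (bernstein_basis a b n x)^T) i j.

Definition ref_col (R : realType)
    (mu : {measure set (measurableTypeR R) -> \bar R}) (u : R -> R) (a b : R)
    (n : nat) : 'cV[R]_n.+1 :=
  \col_i (- 2 * \int[mu]_(x in `[a, b]) (u x * bernstein_basis a b n x i 0)).

Definition ref_cst (R : realType)
    (mu : {measure set (measurableTypeR R) -> \bar R}) (u : R -> R) (a b : R) :
    R :=
  \int[mu]_(x in `[a, b]) (u x ^+ 2).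

Definition coef_set (R : realType)
    (mu : {measure set (measurableTypeR R) -> \bar R}) (u : R -> R)
    (a b M : R) (m n : nat) (eps : R) : set 'cV[R]_n.+1 :=
  [set c |
    [/\ forall i j : nat, (1 <= i <= m)%N -> (j <= n - i)%N ->
          0 <= (-1) ^+ i.-1 * fin_diff c i j,
        c ord0 0 = 0 /\ c ord_max 0 = 1,
        (c^T *m gram_mx mu a b n *m c) 0 0 + ((ref_col mu u a b n)^T *m c) 0 0
          + ref_cst mu u a b <= eps ^+ 2
      & forall j : 'I_n.+1,
          c j 0 <= (* M / (1 - eps) is read as +oo when eps = 1 *)
            if eps == 1 then 1
            else Num.min 1 (M / (1 - eps) * u (a + j%:R * ((b - a) / n%:R)))]].

Arguments coef_set {R} mu u a b M m n eps _.

Definition expected_gap (R : realType) (disp : measure_display)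
    (Omega : measurableType disp) (P : probability Omega R) (a b : R)
    (d n : nat) (X : 'rV[R]_d -> {RV P >-> R}) (Y : {RV P >-> R})
    (z : 'rV[R]_d) (c : 'cV[R]_n.+1) : \bar R :=
  'E_P[(fun w => bernstein a b c (X z w) - bernstein a b c (Y w))%R]%E.

Arguments expected_gap {R disp Omega P} a b {d} n X Y z c.

(* In what follows [T] is the type of decisions, [U] the type of coefficient
   vectors, [Pi z c] the gap and [C] the set of admissible [c]. *)

(* min over C of Pi z, written as an infimum in \bar R. *)
Definition worst_gap (R : realType) (T U : Type) (Pi : T -> U -> \bar R)
    (C : set U) (z : T) : \bar R :=
  ereal_inf [set Pi z c | c in C].

Definition robust_set (R : realType) (T U : Type) (Z : set T)
    (Pi : T -> U -> \bar R) (C : set U) (delta : R) : set T :=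
  [set z | Z z /\ (delta%:E <= worst_gap Pi C z)%E].

(* Optimal value of "maximize f over A", as a supremum in \bar R. *)
Definition max_value (R : realType) (T : Type) (f : T -> R) (A : set T) :
    \bar R :=
  ereal_sup [set (f z)%:E | z in A].

Definition is_maximizer (R : realType) (T : Type) (f : T -> R) (A : set T)
    (z : T) : Prop :=
  A z /\ forall z', A z' -> f z' <= f z.

Definition is_worst_coef (R : realType) (T U : Type) (Pi : T -> U -> \bar R)
    (C : set U) (z : T) (c : U) : Prop :=
  C c /\ forall c', C c' -> (Pi z c <= Pi z c')%E.

(* Cut generation with tolerance gamma. At iteration k, find a maximizer z*_k
   of f over the decisions satisfying the cuts Pi z c^i >= 0 (i = 1, ..., k),
   then a minimizer c*_k of Pi z*_k over C; exit if the minimum is at least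
   - gamma, otherwise add the cut c^(k+1) = c*_k and go to iteration k + 1.
   An execution is recorded by the sequences [z k] = z*_k and [c k] = c*_k,
   so the cuts present at iteration k are [c 0, ..., c (k - 1)]. *)
Definition master_set (R : realType) (T U : Type) (Z : set T)
    (Pi : T -> U -> \bar R) (c : nat -> U) (k : nat) : set T :=
  [set z | Z z /\ forall i, (i < k)%N -> (0 <= Pi z (c i))%E].

Definition cg_iteration (R : realType) (T U : Type) (Z : set T) (f : T -> R)
    (Pi : T -> U -> \bar R) (C : set U) (z : nat -> T) (c : nat -> U)
    (k : nat) : Prop :=
  is_maximizer f (master_set Z Pi c k) (z k) /\ is_worst_coef Pi C (z k) (c k).

(* Iterations 0, ..., N - 1 are carried out, none of them exiting. *)
Definition cg_continues (R : realType) (T U : Type) (Z : set T) (f : T -> R)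
    (Pi : T -> U -> \bar R) (C : set U) (gamma : R) (z : nat -> T)
    (c : nat -> U) (N : nat) : Prop :=
  forall k, (k < N)%N ->
    cg_iteration Z f Pi C z c k /\ (worst_gap Pi C (z k) < (- gamma)%:E)%E.

Definition cg_exits (R : realType) (T U : Type) (Z : set T) (f : T -> R)
    (Pi : T -> U -> \bar R) (C : set U) (gamma : R) (z : nat -> T)
    (c : nat -> U) (N : nat) : Prop :=
  [/\ cg_continues Z f Pi C gamma z c N, cg_iteration Z f Pi C z c N
    & ((- gamma)%:E <= worst_gap Pi C (z N))%E].

(* Whenever an execution reaches iteration N, the master problem has an optimal
   solution, and so has the minimization over C for each such solution. *)
Definition cg_solvable (R : realType) (T U : Type) (Z : set T) (f : T -> R)
    (Pi : T -> U -> \bar R) (C : set U) (gamma : R) : Prop :=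
  forall (z : nat -> T) (c : nat -> U) (N : nat),
    cg_continues Z f Pi C gamma z c N ->
    (exists zN, is_maximizer f (master_set Z Pi c N) zN) /\
    (forall zN, is_maximizer f (master_set Z Pi c N) zN ->
       exists cN, is_worst_coef Pi C zN cN).

(* No execution, whatever optimal solutions are selected, runs forever, and
   some execution reaches the exit. *)
Definition cg_terminates (R : realType) (T U : Type) (Z : set T) (f : T -> R)
    (Pi : T -> U -> \bar R) (C : set U) (gamma : R) : Prop :=
  (forall (z : nat -> T) (c : nat -> U),
     ~ (forall N, cg_continues Z f Pi C gamma z c N)) /\
  (exists (z : nat -> T) (c : nat -> U) (N : nat),
     cg_exits Z f Pi C gamma z c N).

(* Main.v *)
(* Every admissible coefficient vector lies in the unit cube: it starts at 0, is
   nondecreasing by (B1) with i = 1, and is at most 1 by (B4).  The Bernstein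
   basis is a partition of unity, so [Pi z] is 2-Lipschitz for the sup norm on
   coefficients, uniformly in z.  If iteration k does not exit, then
   Pi z_k c_k < - gamma whereas Pi z_k c_i >= 0 for all earlier cuts c_i; hence
   the cuts are pairwise at sup distance more than gamma / 2, and the pigeonhole
   principle in the cube bounds their number.  The bounds on the final value hold
   because every cut is an element of C (so the master problem relaxes the
   robust one) and because the final maximizer lies in the robust set of level
   - gamma. *)
Require Import Defs.
From mathcomp Require Import all_boot all_order all_algebra.
From mathcomp Require Import all_classical all_reals all_analysis.
From mathcomp Require Import measurable_realfun zify lra.

Set Implicit Arguments.
Unset Strict Implicit.
Unset Printing Implicit Defensive.

Import Order.TTheory GRing.Theory Num.Theory.
Import numFieldNormedType.Exports.

Local Open Scope classical_set_scope.
Local Open Scope ring_scope.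

(** * Cut generation for an arbitrary gap function *)

Section CutGeneration.
Variables (R : realType) (T U : Type) (Z : set T) (f : T -> R).
Variables (Pi : T -> U -> \bar R) (C : set U) (gamma : R).

Lemma is_worst_coefE z c : is_worst_coef Pi C z c -> worst_gap Pi C z = Pi z c.
Proof.
move=> [Cc cmin]; apply/eqP; rewrite eq_le; apply/andP; split.
  by apply: ereal_inf_lbound; exists c.
by apply/ereal_infP => _ [c' Cc' <-]; exact: cmin.
Qed.

Lemma robust_set_sub_master z c N :
  cg_continues Z f Pi C gamma z c N ->
  robust_set Z Pi C 0 `<=` master_set Z Pi c N.
Proof.
move=> run x [Zx x0]; split=> // i /run[[_ [Cci _]] _].
by apply: (le_trans x0); apply: ereal_inf_lbound; exists (c i).
Qed.

Lemma cg_exits_value z c N : cg_exits Z f Pi C gamma z c N ->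
  (max_value f (robust_set Z Pi C 0) <= max_value f (master_set Z Pi c N)
   <= max_value f (robust_set Z Pi C (- gamma)))%E.
Proof.
move=> [run [[[ZzN _] zmax] _] exitN]; apply/andP; split.
  exact/ereal_sup_le/image_subset/(robust_set_sub_master run).
apply/ereal_supP => _ [x mx <-]; apply: (@le_trans _ _ (f (z N))%:E).
  by rewrite lee_fin zmax.
by apply: ereal_sup_ubound; exists (z N).
Qed.

(** Iteration [k] reads no entry beyond index [k], so later entries of a recorded run may be
    overwritten. *)
Lemma cg_iteration_ext z c z' c' k :
  {in leq^~ k, z =1 z'} -> {in leq^~ k, c =1 c'} ->
  cg_iteration Z f Pi C z c k -> cg_iteration Z f Pi C z' c' k.
Proof.
move=> ez ec; rewrite /cg_iteration -ez ?unfold_in// -ec ?unfold_in//.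
suff -> : master_set Z Pi c k = master_set Z Pi c' k by [].
by apply/seteqP; split=> x [Zx xc]; split=> // i ik; have := xc _ ik;
  rewrite ec// unfold_in ltnW.
Qed.

(** Induction on [N]: solvability extends a non-exiting run by one iteration, which either exits or
    continues. [z0] and [c0] only fill the sequences of the empty run. *)
Lemma cg_exits_or_continues (z0 : T) (c0 : U) N : cg_solvable Z f Pi C gamma ->
  (exists z c K, cg_exits Z f Pi C gamma z c K) \/
  (exists z c, cg_continues Z f Pi C gamma z c N).
Proof.
move=> solv; elim: N => [|N [?|[z [c run]]]]; [|by left|].
  by right; exists (fun=> z0), (fun=> c0).
have [[zN zNmax] /(_ _ zNmax)[cN cNmin]] := solv _ _ _ run.
(* Overwriting entry [N] keeps the iterations below [N], and the master problem at [N] only involves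
   cuts of index below [N]. *)
pose z' k := if k == N then zN else z k.
pose c' k := if k == N then cN else c k.
have run' : cg_continues Z f Pi C gamma z' c' N.
  move=> k kN; have [itk gapk] := run _ kN; split; last first.
    by rewrite /z' ifN// ltn_eqF.
  by apply: cg_iteration_ext itk => i; rewrite unfold_in => ik;
    rewrite /z' /c' ifN// ltn_eqF// (leq_ltn_trans ik).
have itN : cg_iteration Z f Pi C z' c' N.
  split; last by rewrite /z' /c' eqxx.
  suff -> : master_set Z Pi c' N = master_set Z Pi c N by rewrite /z' eqxx.
  apply/seteqP; split=> x [Zx xc]; split=> // i iN; have := xc _ iN;
    by rewrite /c' (ltn_eqF iN).
have [exitN|contN] := leP (- gamma)%:E (worst_gap Pi C (z' N)).
  by left; exists z', c', N.
right; exists z', c' => k; rewrite ltnS leq_eqVlt => /predU1P[->//|].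
exact: run'.
Qed.

Lemma cg_terminates_bounded (z0 : T) (c0 : U) N : cg_solvable Z f Pi C gamma ->
  (forall z c, ~ cg_continues Z f Pi C gamma z c N) ->
  cg_terminates Z f Pi C gamma.
Proof.
move=> solv bnd; split=> [z c run|]; first exact: bnd (run N).
by have [//|[z [c /bnd]]] := cg_exits_or_continues z0 c0 N solv.
Qed.

Lemma cg_continues_sep z c N i k : cg_continues Z f Pi C gamma z c N ->
  (i < k < N)%N ->
  [/\ Z (z k), (0 <= Pi (z k) (c i))%E & (Pi (z k) (c k) < (- gamma)%:E)%E].
Proof.
move=> run /andP[ik kN]; have [[[[Zz cuts] _] worst] gap] := run _ kN.
by split; [|exact: cuts|rewrite -(is_worst_coefE worst)].
Qed.

End CutGeneration.

(** Each coordinate is rounded down to a multiple of [1 / K], where [1 / K < e]; two vectors with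
    the same rounding are within [e]. *)
Lemma cube_pigeonhole (R : realType) (n : nat) (e : R) : 0 < e ->
  exists N, forall c : nat -> 'cV[R]_n,
    (forall k, (k < N)%N -> forall j, 0 <= c k j 0 <= 1) ->
    exists i k, (i < k < N)%N /\ forall j, `|c i j 0 - c k j 0| <= e.
Proof.
move=> e0; pose K := (Num.truncn e^-1).+1.
have K0 : 0 < K%:R :> R by rewrite ltr0n.
have eK : e^-1 < K%:R by have /andP[] := truncn_itv (ltW (etrans (invr_gt0 e) e0)).
(* One vector more than there are cells; [K.+1] values per coordinate because coordinate 1 truncates
   to [K], so [inord] never takes its default. *)
exists #|{ffun 'I_n -> 'I_K.+1}|.+1 => c c01.
pose bin (k : 'I_#|{ffun 'I_n -> 'I_K.+1}|.+1) : {ffun 'I_n -> 'I_K.+1} :=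
  [ffun j => inord (Num.truncn (c k j 0 * K%:R))].
have /injectivePn[i [k ik ebin]] : ~~ injectiveb bin.
  by apply/injectiveP => /leq_card; rewrite card_ord ltnn.
have close j : `|c i j 0 - c k j 0| <= e.
  have trunc_itv (l : 'I_#|{ffun 'I_n -> 'I_K.+1}|.+1) :
      (bin l j)%:R <= c l j 0 * K%:R < (bin l j).+1%:R.
    have /andP[c0 c1] := c01 _ (ltn_ord l) j.
    have cK0 : 0 <= c l j 0 * K%:R by rewrite mulr_ge0// ltW.
    rewrite ffunE inordK ?truncn_itv// ltnS -(ler_nat R).
    have /andP[/le_trans-> //] := truncn_itv cK0.
    by rewrite ler_piMl// ltW.
  have := trunc_itv i; have := trunc_itv k; rewrite ebin -(natr1 (bin k j)).
  move=> /andP[k0 k1] /andP[i0 i1].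
  have : `|c i j 0 - c k j 0| * K%:R <= 1.
    rewrite -(ger0_norm (ltW K0)) -normrM mulrBl ler_norml; lra.
  rewrite -ler_pdivlMr// mul1r => /le_trans; apply.
  by rewrite -[leRHS]invrK lef_pV2 ?posrE ?invr_gt0// ltW.
have [lt_ik|lt_ki|/val_inj/eqP] := ltngtP i k; last by rewrite (negPf ik).
- by exists i, k; rewrite lt_ik ltn_ord.
- by exists k, i; rewrite lt_ki ltn_ord; split=> // j; rewrite distrC.
Qed.

Lemma coef_set_itv (R : realType)
    (mu : {measure set (measurableTypeR R) -> \bar R}) (u : R -> R) (a b M : R)
    (m n : nat) (eps : R) (c : 'cV[R]_n.+1) :
  (0 < m)%N -> coef_set mu u a b M m n eps c -> forall j, 0 <= c j 0 <= 1.
Proof.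
move=> m0 [diff_ge0 [c0 _] _ c_le] j; apply/andP; split; last first.
  by apply: (le_trans (c_le j)); case: ifP => // _; rewrite ge_min lexx.
case: j => j; elim: j => [|j IH] jn.
  by rewrite (_ : Ordinal jn = ord0) ?c0//; exact: val_inj.
apply: le_trans (IH (ltnW jn)) _.
have jn1 : (j <= n - 1)%N by lia.
(* (B1) with [i = 1] unfolds to [c_j <= c_(j+1)]. *)
have := diff_ge0 1%N j m0 jn1; rewrite /fin_diff !big_ord_recl big_ord0 /=.
rewrite /bump /= bin0 bin1 !expr0 expr1 mulN1r !mul1r addr0 mulN1r subn0 addn1 subn1 /= subr_ge0.
rewrite (_ : inord j = Ordinal (ltnW jn)); last first.
  by apply: val_inj; rewrite /= inordK// ltnW.
rewrite (_ : inord j.+1 = Ordinal jn)//.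
by apply: val_inj; rewrite /= inordK.
Qed.

(** * Bernstein polynomials as averages of their coefficients *)

Section Bernstein.
Variables (R : realType) (a b : R) (n : nat).
Hypothesis hab : a < b.

Lemma bernsteinE (c : 'cV[R]_n.+1) x :
  bernstein a b c x = \sum_j c j 0 * bernstein_basis a b n x j 0.
Proof. by rewrite /bernstein mxE; apply: eq_bigr => j _; rewrite !mxE. Qed.

(** Binomial expansion of [((1 - t) + t) ^+ n]. *)
Lemma sum_bernstein_basis x : \sum_j bernstein_basis a b n x j 0 = 1.
Proof.
set t := (x - a) / (b - a).
rewrite -[RHS](expr1n _ n) -(subrK t 1) exprDn; apply: eq_bigr => j _.
by rewrite mxE -/t -[RHS]mulr_natl -mulrA [X in _ * X]mulrC.
Qed.

Lemma bernstein_basis_ge0 x j : x \in `[a, b] -> 0 <= bernstein_basis a b n x j 0.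
Proof.
rewrite in_itv/= => /andP[ax xb]; have ba : 0 < b - a by rewrite subr_gt0.
rewrite mxE !mulr_ge0 ?ler0n// exprn_ge0//.
  by rewrite divr_ge0 ?subr_ge0// ltW.
by rewrite subr_ge0 ler_pdivrMr// mul1r lerD2r.
Qed.

Lemma bernstein_dist (c c' : 'cV[R]_n.+1) e x : x \in `[a, b] ->
  (forall j, `|c j 0 - c' j 0| <= e) ->
  `|bernstein a b c x - bernstein a b c' x| <= e.
Proof.
move=> xab cc'; rewrite !bernsteinE -sumrB.
apply: le_trans (ler_norm_sum _ _ _) _.
rewrite -[e]mulr1 -(sum_bernstein_basis x) mulr_sumr; apply: ler_sum => j _.
rewrite -mulrBl normrM (ger0_norm (bernstein_basis_ge0 _ xab)).
by rewrite ler_wpM2r// bernstein_basis_ge0.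
Qed.

Lemma measurable_bernstein (c : 'cV[R]_n.+1) :
  measurable_fun setT (bernstein a b c).
Proof.
rewrite (_ : bernstein a b c = fun x => \sum_j c j 0 * bernstein_basis a b n x j 0);
  last by apply/funext => x; exact: bernsteinE.
apply: measurable_sum => j; under eq_fun => x do rewrite mxE.
have mt : measurable_fun setT (fun x : R => (x - a) / (b - a)).
  by apply: measurable_funM => //; exact: measurable_funB.
apply: measurable_funM => //; apply: measurable_funM; last first.
  by apply: measurable_funX; exact: measurable_funB.
by apply: measurable_funM => //; exact: measurable_funX.
Qed.

Lemma bernstein_bounded (c : 'cV[R]_n.+1) x : x \in `[a, b] ->
  `|bernstein a b c x| <= \sum_j `|c j 0|.
Proof.
move=> xab; have := @bernstein_dist c 0 (\sum_j `|c j 0|) x xab.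
have -> : bernstein a b (0 : 'cV_n.+1) x = 0.
  by rewrite /bernstein trmx0 mul0mx mxE.
rewrite subr0; apply=> j; rewrite mxE subr0 (bigD1 j)//= lerDl.
by apply: sumr_ge0.
Qed.

(** * Lipschitz dependence of the expected gap on the coefficients *)

Section Expectation.
Variables (disp : measure_display) (Omega : measurableType disp).
Variables (P : probability Omega R) (d : nat).
Variables (X : 'rV[R]_d -> {RV P >-> R}) (Y : {RV P >-> R}) (z : 'rV[R]_d).
Hypotheses (hX : forall w, X z w \in `[a, b]) (hY : forall w, Y w \in `[a, b]).

Lemma integrable_bernstein_gap (c : 'cV[R]_n.+1) : P.-integrable setT
  (EFin \o (fun w => bernstein a b c (X z w) - bernstein a b c (Y w))).
Proof.
apply: measurable_bounded_integrable => //.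
- by apply: le_lt_trans (ltry 1); rewrite probability_le1.
- apply: measurable_funB.
  + by apply: (measurableT_comp (measurable_bernstein c)).
  + by apply: (measurableT_comp (measurable_bernstein c)).
- exists (\sum_j `|c j 0| *+ 2); split; first exact: num_real.
  move=> K ltK w _; apply: le_trans (ltW ltK).
  apply: le_trans (ler_normB _ _) _.
  by rewrite sumrMnl mulr2n lerD// bernstein_bounded.
Qed.

(** The factor 2 comes from the two polynomial values, at [X z] and at [Y], each moving by at most
    [e]. *)
Lemma expected_gap_dist (c c' : 'cV[R]_n.+1) e :
  (forall j, `|c j 0 - c' j 0| <= e) ->
  (expected_gap a b n X Y z c <= expected_gap a b n X Y z c' + (e *+ 2)%:E)%E.
Proof.
(* Writing the constant as an expectation reduces the claim to a pointwise comparison of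
   integrands. *)
move=> cc'; rewrite -[(e *+ 2)%:E](expectation_cst P) /expected_gap unlock.
have ie : P.-integrable setT (EFin \o cst (e *+ 2)).
  exact: finite_measure_integrable_cst.
have ic := integrable_bernstein_gap c; have ic' := integrable_bernstein_gap c'.
rewrite -integralD//; apply: le_integral => //; first exact: integrableD.
move=> w _; rewrite -EFinD lee_fin /=.
have := bernstein_dist (hX w) cc'; have := bernstein_dist (hY w) cc'.
rewrite !ler_norml; lra.
Qed.

End Expectation.
End Bernstein.

Theorem theorem4 (R : realType) (a b : R) (hab : a < b)
  (disp : measure_display) (Omega : measurableType disp)
  (P : probability Omega R)
  (u : R -> R)
  (hu_incr : {in `[a, b] &, {homo u : x y / x <= y}})
  (hu_conc : concave_function (`[a, b] : set R^o) u)
  (hua : u a = 0) (hub : u b = 1)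
  (mu : {measure set (measurableTypeR R) -> \bar R})
  (hmu : mu `[a, b]%classic = 1%E)
  (M : R) (hM : 1 < M)
  (d : nat) (Z : set 'rV[R]_d) (f : 'rV[R]_d -> R)
  (X : 'rV[R]_d -> {RV P >-> R}) (Y : {RV P >-> R})
  (hX : forall z, Z z -> forall w, X z w \in `[a, b])
  (hY : forall w, Y w \in `[a, b])
  (m n : nat) (hm : (2 <= m)%N) (hmn : (m <= n)%N)
  (eps : R) (heps : 0 <= eps <= 1)
  (gamma : R) (hgamma : 0 < gamma) :
  let C := coef_set mu u a b M m n eps in
  let Pi := expected_gap a b n X Y in
  cg_solvable Z f Pi C gamma ->
  cg_terminates Z f Pi C gamma /\
  (forall (z : nat -> 'rV[R]_d) (c : nat -> 'cV[R]_n.+1) (N : nat),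
     cg_exits Z f Pi C gamma z c N ->
     (max_value f (robust_set Z Pi C 0) <= max_value f (master_set Z Pi c N)
      <= max_value f (robust_set Z Pi C (- gamma)))%E).
Proof.
move=> C Pi solv; split; last by move=> z c N; exact: cg_exits_value.
(* Coefficients within [gamma / 4] change the gap by at most [gamma / 2], too little to pass from
   below [- gamma] to 0. *)
have e0 : 0 < gamma / 4 by lra.
have [N close] := cube_pigeonhole n.+1 e0.
apply: (@cg_terminates_bounded _ _ _ _ _ _ _ _ 0 0 N) => // z c run.
have [k kN|i [k [ikN cc]]] := close c.
  have [[_ [Ck _]] _] := run _ kN.
  by apply: coef_set_itv Ck; exact: ltn_trans hm.
(* Two close cuts [c i] and [c k] are compared at the later decision [z k], where their gaps differ
   by more than [gamma]. *)
have [Zz Pii Pik] := cg_continues_sep run ikN.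
have := expected_gap_dist hab (hX _ Zz) hY cc.
move=> /(le_trans Pii); apply/negP; rewrite -ltNge.
apply: (@lt_le_trans _ _ ((- gamma)%:E + (gamma / 4 *+ 2)%:E)%E).
  by rewrite lteD2rE.
rewrite -EFinD lee_fin; lra.
Qed.
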